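(* For every integer $g\ge 1$, the ring $\mathfrak{A}^{(g)}$ generated over $\mathbb{C}$ by the genus-$g$ weight enumerators of the codes $d_n^+$ ($n\equiv 0\pmod 8$, $n>0$) and of their Type II neighbors is finitely generated over $\mathbb{C}$.
   Context: A binary code of length $n$ is a linear subspace of $\mathbb{F}_2^n$ with inner product $u\cdot v=\sum_i u_iv_i$; it is self-dual if it equals its dual. A Type II code is a binary self-dual code all of whose codewords have weight (number of nonzero coordinates) divisible by $4$. Two self-dual codes of length $n$ are neighbors if their intersection has dimension $\frac n2-1$. For $n\equiv 0\pmod 8$, $d_n^+$ is the Type II code of length $n$ spanned by the vectors with support $\{1,2,2i-1,2i\}$ for $2\le i\le n/2$, together with the vector $(1,0,1,0,\dots,1,0)$. For a Type II code $C$ of length $n$, its weight enumerator in genus $g$ is the homogeneous polynomial of degree $n$ in the $2^g$ variables $x_a$ ($a\in\mathbb{F}_2^g$, written as column vectors) $$W_C^{(g)}(x_a : a\in\mathbb{F}_2^g)=\sum_{u_1,\dots,u_g\in C}\ \prod_{a\in\mathbb{F}_2^g}x_a^{n_a(u_1,\dots,u_g)},$$ where $n_a(u_1,\dots,u_g)$ is the number of $i\in\{1,\dots,n\}$ with $(u_{1i},\dots,u_{gi})^T=a$. $\mathfrak{A}^{(g)}$ is the $\mathbb{C}$-subalgebra of $\mathbb{C}[x_a : a\in\mathbb{F}_2^g]$ generated by all $W_C^{(g)}$ where, for some positive $n\equiv 0\pmod 8$, $C$ is $d_n^+$ or a Type II code that is a neighbor of $d_n^+$. *)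

(* Defs.v *)
From HB Require Import structures.
From mathcomp Require Import all_boot all_order all_algebra.
From mathcomp Require Import reals.
From mathcomp Require Import complex.
From mathcomp Require Import mpoly.

Set Implicit Arguments.
Unset Strict Implicit.
Unset Printing Implicit Defensive.

Import GRing.Theory.
Local Open Scope ring_scope.

Definition dotp n (u v : 'rV['F_2]_n) : 'F_2 := \sum_(i < n) u 0 i * v 0 i.

Definition wt n (u : 'rV['F_2]_n) : nat := #|[set i | u 0 i != 0]|.

Definition dual_code n (C : {vspace 'rV['F_2]_n}) : {pred 'rV['F_2]_n} :=
  [pred v | [forall u in C, dotp u v == 0]].

Definition self_dual n (C : {vspace 'rV['F_2]_n}) : Prop := C =i dual_code C.

Definition type_II n (C : {vspace 'rV['F_2]_n}) : Prop :=
  self_dual C /\ (forall u, u \in C -> (4 %| wt u)%N).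

(* [n] is even and positive in all uses, so neither [n./2] nor the
   subtraction truncates. *)
Definition neighbors n (C D : {vspace 'rV['F_2]_n}) : Prop :=
  [/\ self_dual C, self_dual D & \dim (C :&: D) = (n./2 - 1)%N].

(* The element [j : 'I_n] stands for the coordinate [j.+1] of {1, ..., n}. *)
Definition supp_row n (s : seq nat) : 'rV['F_2]_n :=
  \row_(j < n) (j.+1 \in s)%:R.

(* (1, 0, 1, 0, ..., 1, 0) *)
Definition alt_row n : 'rV['F_2]_n := \row_(j < n) (odd j.+1)%:R.

Definition dplus n : {vspace 'rV['F_2]_n} :=
  <<alt_row n
    :: [seq supp_row n [:: 1; 2; 2 * i - 1; 2 * i]%N
         | i <- index_iota 2 (n./2).+1]>>%VS.

(* n_a(u_1, ..., u_g) *)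
Definition col_count g n (u : {ffun 'I_g -> 'rV['F_2]_n})
    (a : 'cV['F_2]_g) : nat :=
  #|[set i : 'I_n | (\col_(k < g) u k 0 i) == a]|.

(* The variable x_a is the one whose index is the rank of [a] in the
   enumeration of F_2^g. *)
Definition wt_enum (K : comNzRingType) g n (C : {vspace 'rV['F_2]_n}) :
    {mpoly K[#|{: 'cV['F_2]_g}|]} :=
  \sum_(u : {ffun 'I_g -> 'rV['F_2]_n} | [forall k, u k \in C])
    \prod_(a : 'cV['F_2]_g) 'X_(enum_rank a) ^+ col_count u a.

(* The (unital) K-subalgebra of [A] generated by the set [S]. *)
Inductive subalg_gen (K : comNzRingType) (A : algType K) (S : A -> Prop) :
    A -> Prop :=
  | SubalgGen x : S x -> subalg_gen S x
  | SubalgScalar (c : K) : subalg_gen S c%:A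
  | SubalgAdd x y : subalg_gen S x -> subalg_gen S y -> subalg_gen S (x + y)
  | SubalgMul x y : subalg_gen S x -> subalg_gen S y -> subalg_gen S (x * y).

Definition finitely_generated (K : comNzRingType) (A : algType K)
    (B : A -> Prop) : Prop :=
  exists s : seq A, forall x, B x <-> subalg_gen (fun y => y \in s) x.

Definition frakA (K : comNzRingType) g :
    {mpoly K[#|{: 'cV['F_2]_g}|]} -> Prop :=
  subalg_gen (fun p => exists n (C : {vspace 'rV['F_2]_n}),
    [/\ (0 < n)%N, (8 %| n)%N,
        C = dplus n \/ (type_II C /\ neighbors (dplus n) C)
      & p = wt_enum K g C]).

(* Main.v *)
Require Import Defs.
From mathcomp Require Import all_boot all_order all_algebra.
From mathcomp Require Import reals.
From mathcomp Require Import complex.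
From mathcomp Require Import mpoly.
From mathcomp Require Import ring zify.

Set Implicit Arguments.
Unset Strict Implicit.
Unset Printing Implicit Defensive.

Import GRing.Theory Num.Theory.
Local Open Scope ring_scope.

(** Write m = n/2 and group the n coordinates into m pairs.  For b, x in F_2^g
    put theta(b,x) = sum_a (-1)^(x.a) X_a X_(a+b), the polynomial form of the
    square of a theta constant; it vanishes when the quadratic form x.b is
    nonzero.  Let h and h' range over the characteristics (b,x).

    A word of d_n^+ is a word c of even weight in F_2^m, doubled into the pairs
    (c_j, c_j) or (c_j + 1, c_j).  Detecting the evenness with the characters
    of F_2^g gives
      2^g W(d_n^+) = sum_h theta(h)^m      ([wt_enum_dplus]),
    a power sum with 4 | m.  A neighbor is determined by a vector v outside
    d_n^+: it consists of the words x orthogonal to v with x - e v in d_n^+ for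
    some e ([neighbors_neighbor_of]).  If t is the number of pairs on which v
    has two different entries and s = m - t, the same Fourier argument with two
    parity checks gives
      4^g W = sum_(h,h') +- theta(h)^s theta(h')^t      ([wt_enum_neighbor]),
    with an explicit sign.  As v has weight divisible by 4, either 4 divides
    both s and t, and then the sum factors into power sums, or s and t are
    both 2 modulo 4, and the sign is (-1)^q(h+h') with q(b,x) = x.b.  All such
    pairs (s,t) occur ([neighbor_vector_exists]).  With Y_h = theta(h)^4 the
    ring is therefore generated by the power sums of the finitely many Y_h and
    by the forms
      sum_(h,h') B(h,h') Y_h^i Y_h'^j,
      B(h,h') = (-1)^q(h+h') theta(h)^2 theta(h')^2
    ([frakA_power_forms]).

    Any ring of this shape is finitely generated ([power_forms_fg]).  By
    Newton's identities the coefficients of f = prod_h (T - Y_h) are polynomials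
    in the first N power sums, where N = deg f; and f(Y_h) = 0 rewrites each
    power Y_h^i with i >= N through lower powers with these coefficients, which
    do not depend on h.  So the power sums of exponent at most N and the forms
    with i, j < N suffice. *)

(** * Subalgebras generated by power sums and bilinear power forms *)

Lemma subalg_trans (K : comNzRingType) (A : algType K) (S T : A -> Prop) :
  (forall x, S x -> subalg_gen T x) ->
  forall x, subalg_gen S x -> subalg_gen T x.
Proof.
move=> sST x; elim=> {x} [x /sST //|c|x y _ Tx _ Ty|x y _ Tx _ Ty].
- exact: SubalgScalar.
- exact: SubalgAdd.
- exact: SubalgMul.
Qed.

Lemma subalgZ (K : comNzRingType) (A : algType K) (S : A -> Prop) c x :
  subalg_gen S x -> subalg_gen S (c *: x).
Proof.
move=> Sx; rewrite -mulr_algl; apply: SubalgMul => //; exact: SubalgScalar.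
Qed.

Lemma subalg_natr (K : comNzRingType) (A : algType K) (S : A -> Prop) n :
  subalg_gen S n%:R.
Proof. by rewrite -(scaler_nat n 1); exact: SubalgScalar. Qed.

Lemma subalgN (K : comNzRingType) (A : algType K) (S : A -> Prop) x :
  subalg_gen S x -> subalg_gen S (- x).
Proof. by rewrite -scaleN1r; apply: subalgZ. Qed.

Lemma subalg_sum (K : comNzRingType) (A : algType K) (S : A -> Prop)
    (I : Type) (r : seq I) (P : pred I) (F : I -> A) :
  (forall i, P i -> subalg_gen S (F i)) ->
  subalg_gen S (\sum_(i <- r | P i) F i).
Proof.
move=> SF; elim/big_rec: _ => [|i x Pi Sx]; first exact: (subalg_natr S 0).
by apply: SubalgAdd => //; apply: SF.
Qed.

(** This is where characteristic zero enters: identities obtained up to a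
    positive integer factor still give membership. *)
Lemma subalg_divn (K : numFieldType) (A : algType K) (S : A -> Prop) n x :
  (0 < n)%N -> subalg_gen S (x *+ n) -> subalg_gen S x.
Proof.
move=> n0 Sx.
have -> : x = n%:R^-1 *: (x *+ n).
  by rewrite -scaler_nat scalerA mulVf ?scale1r // pnatr_eq0 -lt0n.
exact: subalgZ.
Qed.

Definition root_poly (A : comNzRingType) (H : finType) (Y : H -> A) :
    {poly A} := \prod_h ('X - (Y h)%:P).

Lemma size_root_poly (A : comNzRingType) (H : finType) (Y : H -> A) :
  size (root_poly Y) = #|H|.+1.
Proof. by rewrite size_prod_XsubC /index_enum -enumT -cardT. Qed.

Lemma root_poly_lead (A : comNzRingType) (H : finType) (Y : H -> A) :
  (root_poly Y)`_#|H| = 1.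
Proof.
have /monicP <- : root_poly Y \is monic by apply: monic_prod_XsubC.
by rewrite lead_coefE size_root_poly.
Qed.

Lemma deriv_prod (A : comNzRingType) (I : eqType) (r : seq I)
    (F : I -> {poly A}) : uniq r ->
  (\prod_(i <- r) F i)^`() =
  \sum_(i <- r) (F i)^`() * \prod_(j <- r | j != i) F j.
Proof.
elim: r => [|i r IHr] /=; first by rewrite !big_nil derivC.
case/andP=> i_r /IHr IH; rewrite !big_cons eqxx derivM IH.
congr (_ * _ + _).
  rewrite [LHS]big_seq [RHS]big_seq_cond; apply: eq_bigl => j.
  by case: eqP => [->|]; rewrite ?(negPf i_r) ?andbT.
rewrite mulr_sumr [LHS]big_seq [RHS]big_seq; apply: eq_bigr => j j_r.
have i_j : i != j by apply: contraNneq i_r => ->.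
by rewrite big_cons i_j mulrCA.
Qed.

(** The coefficients u_i of T f / (T - y) satisfy u_i = f_i + y u_(i+1), so they
    are the Horner partial sums of f at y.  Multiplying the cofactor by T makes
    the formula hold down to index 0, so that Newton's identity below also
    covers j = N. *)
Lemma root_poly_cofactor (A : comNzRingType) (H : finType) (Y : H -> A) h j :
  (j <= #|H|)%N ->
  ('X * \prod_(h' | h' != h) ('X - (Y h')%:P))`_(#|H| - j) =
  \sum_(l < j.+1) (root_poly Y)`_(#|H| - j + l) * Y h ^+ l.
Proof.
set G := \prod_(h' | h' != h) _; set f := root_poly Y.
have Ef : f = 'X * G - (Y h)%:P * G.
  by rewrite /f /root_poly (bigD1 h) //= mulrBl.
have rec i : ('X * G)`_i = f`_i + Y h * ('X * G)`_i.+1.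
  by rewrite Ef coefB coefCM [_`_i.+1]coefXM /= subrK.
have top : ('X * G)`_#|H|.+1 = 0.
  rewrite coefXM /=; apply: nth_default.
  rewrite /G -big_filter size_prod_XsubC.
  have -> : size [seq i <- index_enum H | i != h] = #|[set~ h]|.
    rewrite -sum1_size big_filter -sum1_card.
    by apply: eq_bigl => i; rewrite !inE.
  by rewrite cardsC1 prednK //; apply/card_gt0P; exists h.
elim: j => [|j IHj] le_j.
  by rewrite subn0 big_ord1 addn0 expr0 rec top mulr0 addr0 mulr1.
rewrite rec subnSK // IHj 1?ltnW // [RHS]big_ord_recl addn0 expr0 mulr1.
congr (_ + _); rewrite mulr_sumr; apply: eq_bigr => l _.
by rewrite mulrCA -exprS lift0 addnS -addSn subnSK.
Qed.

(** Compare coefficients in T f' = sum_h T f / (T - Y_h); the term l = 0 of the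
    Horner sums contributes N times the coefficient on the left. *)
Lemma newton (A : comNzRingType) (H : finType) (Y : H -> A) j :
  (j <= #|H|)%N ->
  (root_poly Y)`_(#|H| - j) *+ j =
  - \sum_(l < j) (root_poly Y)`_((#|H| - j).+1 + l) * \sum_h Y h ^+ l.+1.
Proof.
move=> le_j; set f := root_poly Y.
have Ef : ('X * f^`())`_(#|H| - j) =
    \sum_(l < j.+1) f`_(#|H| - j + l) * \sum_h Y h ^+ l.
  transitivity (\sum_h ('X * \prod_(h' | h' != h) ('X - (Y h')%:P))`_(#|H| - j)).
    rewrite /f /root_poly deriv_prod ?index_enum_uniq // mulr_sumr coef_sum.
    by apply: eq_bigr => h _; rewrite derivXsubC mul1r.
  under eq_bigr => h _ do rewrite root_poly_cofactor //.
  by rewrite exchange_big; apply: eq_bigr => l _; rewrite mulr_sumr.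
have : f`_(#|H| - j) *+ (#|H| - j) = ('X * f^`())`_(#|H| - j).
  by rewrite coefXM coef_deriv; case: (#|H| - j)%N.
rewrite {}Ef big_ord_recl addn0.
under eq_bigr => h _ do rewrite expr0.
rewrite sumr_const mulr_natr => E.
apply: (addrI (f`_(#|H| - j) *+ (#|H| - j))).
rewrite -mulrnDr subnK // E -addrA.
rewrite [X in _ + (X - _)](_ : _ =
    \sum_(l < j) f`_((#|H| - j).+1 + l) * \sum_h Y h ^+ l.+1).
  by rewrite subrr addr0.
by apply: eq_bigr => l _; rewrite lift0 addnS addSn.
Qed.

Lemma root_poly_relation (A : comNzRingType) (H : finType) (Y : H -> A) h i :
  (#|H| <= i)%N ->
  Y h ^+ i = - \sum_(l < #|H|) (root_poly Y)`_l * Y h ^+ (i - #|H| + l).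
Proof.
move=> le_i; set N := #|H|.
have /eqP : (root_poly Y).[Y h] = 0.
  by rewrite /root_poly (bigD1 h) //= hornerM hornerXsubC subrr mul0r.
rewrite horner_coef size_root_poly big_ord_recr /= root_poly_lead mul1r.
rewrite addrC addr_eq0 => /eqP E.
rewrite -{1}(subnK le_i) exprD E mulrN mulr_sumr; congr (- _).
by apply: eq_bigr => l _; rewrite mulrCA exprD.
Qed.

(** Newton's identity gives j times the coefficient of T^(N - j) in terms of the
    higher coefficients, so j can be divided out by induction. *)
Lemma root_poly_coef_subalg (K : numFieldType) (A : comAlgType K)
    (H : finType) (Y : H -> A) (S : A -> Prop) l :
  (forall k, (0 < k <= #|H|)%N -> subalg_gen S (\sum_h Y h ^+ k)) ->
  subalg_gen S (root_poly Y)`_l.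
Proof.
move=> SP; case: (ltnP #|H| l) => [lt_l|le_l].
  by rewrite nth_default ?size_root_poly //; apply: (subalg_natr S 0).
rewrite -(subKn le_l); have := leq_subr l #|H|.
elim/ltn_ind: (#|H| - l)%N => -[|j] IH le_j.
  by rewrite subn0 root_poly_lead; apply: (subalg_natr S 1).
apply: (@subalg_divn _ _ _ j.+1) => //; rewrite newton //.
apply/subalgN/subalg_sum => k _; apply: SubalgMul; last first.
  by apply: SP; rewrite /= (leq_trans (ltn_ord k)).
have -> : ((#|H| - j.+1).+1 + k = #|H| - (j - k))%N.
  by have := ltn_ord k; lia.
by apply: IH; have := ltn_ord k; lia.
Qed.

Definition power_form_gen (A : comNzRingType) (H : finType) (Y : H -> A)
    (B : H -> H -> A) (x : A) : Prop :=
  (exists k, x = \sum_h Y h ^+ k.+1) \/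
  (exists i j, x = \sum_h \sum_h' B h h' * Y h ^+ i * Y h' ^+ j).

(** Exponents at least N are lowered with the relation f(Y_h) = 0, first in i,
    then in j, then in the power sums. *)
Lemma power_forms_fg (K : numFieldType) (A : comAlgType K)
    (H : finType) (Y : H -> A) (B : H -> H -> A) :
  exists s : seq A, (forall x, x \in s -> power_form_gen Y B x) /\
    (forall x, power_form_gen Y B x -> subalg_gen (fun y => y \in s) x).
Proof.
set N := #|H|.
pose P k := \sum_h Y h ^+ k.
pose q i j := \sum_h \sum_h' B h h' * Y h ^+ i * Y h' ^+ j.
pose s := [seq P k.+1 | k <- iota 0 N]
  ++ [seq q i j | i <- iota 0 N, j <- iota 0 N].
exists s; split=> [x|].
  rewrite mem_cat => /orP[/mapP[k _ ->]|/allpairsP[[i j] [_ _ ->]]].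
    by left; exists k.
  by right; exists i, j.
pose S y := y \in s.
have SP k : (0 < k <= N)%N -> subalg_gen S (P k).
  case: k => //= k le_k; apply: SubalgGen; rewrite /S mem_cat.
  by rewrite (map_f (fun k => P k.+1)) // mem_iota.
have Sf l : subalg_gen S (root_poly Y)`_l by apply: root_poly_coef_subalg.
have Sq0 i j : (i < N)%N -> (j < N)%N -> subalg_gen S (q i j).
  move=> ltiN ltjN; apply: SubalgGen; rewrite /S mem_cat orbC.
  by rewrite (allpairs_f q) // mem_iota.
have Sq1 i j : (j < N)%N -> subalg_gen S (q i j).
  move=> ltjN; elim/ltn_ind: i => i IH.
  case: (ltnP i N) => [|leNi]; first by move=> ?; apply: Sq0.
  have -> : q i j = - \sum_(l < N) (root_poly Y)`_l * q (i - N + l)%N j.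
    rewrite /q; under [in RHS]eq_bigr => l _ do rewrite mulr_sumr.
    rewrite [in RHS]exchange_big -sumrN; apply: eq_bigr => h _.
    under [in RHS]eq_bigr => l _ do rewrite mulr_sumr.
    rewrite [in RHS]exchange_big -sumrN; apply: eq_bigr => h' _.
    rewrite [Y h ^+ i]root_poly_relation // mulrN mulNr mulr_sumr mulr_suml.
    by congr (- _); apply: eq_bigr => l _; rewrite -/N; ring.
  apply/subalgN/subalg_sum => l _; apply: SubalgMul => //.
  by apply: IH; have := ltn_ord l; lia.
have Sq i j : subalg_gen S (q i j).
  elim/ltn_ind: j => j IH.
  case: (ltnP j N) => [|leNj]; first by move=> ?; apply: Sq1.
  have -> : q i j = - \sum_(l < N) (root_poly Y)`_l * q i (j - N + l)%N.
    rewrite /q; under [in RHS]eq_bigr => l _ do rewrite mulr_sumr.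
    rewrite [in RHS]exchange_big -sumrN; apply: eq_bigr => h _.
    under [in RHS]eq_bigr => l _ do rewrite mulr_sumr.
    rewrite [in RHS]exchange_big -sumrN; apply: eq_bigr => h' _.
    rewrite [Y h' ^+ j]root_poly_relation // mulrN mulr_sumr.
    by congr (- _); apply: eq_bigr => l _; rewrite -/N; ring.
  apply/subalgN/subalg_sum => l _; apply: SubalgMul => //.
  by apply: IH; have := ltn_ord l; lia.
have SPk k : subalg_gen S (P k.+1).
  elim/ltn_ind: k => k IH.
  case: (leqP k.+1 N) => [le_k|ltNk]; first by apply: SP.
  have -> : P k.+1 = - \sum_(l < N) (root_poly Y)`_l * P (k.+1 - N + l)%N.
    rewrite /P; under [in RHS]eq_bigr => l _ do rewrite mulr_sumr.
    rewrite [in RHS]exchange_big -sumrN; apply: eq_bigr => h _.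
    by rewrite root_poly_relation // ltnW.
  apply/subalgN/subalg_sum => l _; apply: SubalgMul => //.
  have -> : (k.+1 - N + l = (k - N + l).+1)%N by lia.
  by apply: IH; have := ltn_ord l; lia.
by move=> x [[k ->]|[i [j ->]]]; [apply: SPk | apply: Sq].
Qed.

(** * Neighbors of a binary self-dual code *)

Lemma F2_cases (x : 'F_2) : x = 0 \/ x = 1.
Proof. by case: x => [[|[|//]] ?]; [left|right]; apply: val_inj. Qed.

Lemma F2_addxx (x : 'F_2) : x + x = 0.
Proof. by rewrite addrr_pchar2 // pchar_Fp. Qed.

Lemma F2_oppr (x : 'F_2) : - x = x.
Proof. by rewrite oppr_pchar2 // pchar_Fp. Qed.

Lemma F2_mulxx (x : 'F_2) : x * x = x.
Proof. by case: (F2_cases x) => ->; rewrite ?mulr0 ?mulr1. Qed.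

Lemma F2_neq0 (x : 'F_2) : x != 0 -> x = 1.
Proof. by case: (F2_cases x) => -> //; rewrite eqxx. Qed.

Lemma F2_natr (x : 'F_2) : x = (x != 0)%:R.
Proof. by case: (F2_cases x) => ->; rewrite ?eqxx ?oner_eq0. Qed.

(** Proves a statement about quantified elements of F_2 by trying all values;
    it stands in for ring normalization in characteristic 2. *)
Ltac F2_decide :=
  repeat (let x := fresh "x" in intro x; case: (F2_cases x) => ->);
  first [done | by apply/eqP].

Lemma F2_natr_eq0 n : (n%:R == 0 :> 'F_2) = (2 %| n)%N.
Proof. by rewrite (dvdn_pcharf (pchar_Fp (isT : prime 2))). Qed.

Lemma dotpC n (u v : 'rV['F_2]_n) : dotp u v = dotp v u.
Proof. by apply: eq_bigr => i _; rewrite mulrC. Qed.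

Lemma dotpDl n (u u' v : 'rV['F_2]_n) : dotp (u + u') v = dotp u v + dotp u' v.
Proof.
by rewrite /dotp -big_split; apply: eq_bigr => i _; rewrite mxE mulrDl.
Qed.

Lemma dotpZl n a (u v : 'rV['F_2]_n) : dotp (a *: u) v = a * dotp u v.
Proof. by rewrite /dotp mulr_sumr; apply: eq_bigr => i _; rewrite mxE mulrA. Qed.

Lemma dotpBl n (u u' v : 'rV['F_2]_n) : dotp (u - u') v = dotp u v - dotp u' v.
Proof. by rewrite dotpDl -scaleN1r dotpZl mulN1r. Qed.

Lemma dotpZr n a (u v : 'rV['F_2]_n) : dotp u (a *: v) = a * dotp u v.
Proof. by rewrite dotpC dotpZl dotpC. Qed.

Lemma dotpBr n (u v v' : 'rV['F_2]_n) : dotp u (v - v') = dotp u v - dotp u v'.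
Proof. by rewrite dotpC dotpBl !(dotpC u). Qed.

Lemma dotp_mx n (u v : 'rV['F_2]_n) : dotp u v = (u *m v^T) 0 0.
Proof. by rewrite mxE; apply: eq_bigr => i _; rewrite mxE. Qed.

Lemma dotp_row k n (A : 'M['F_2]_(k, n)) (u : 'rV_n) i :
  (u *m A^T) 0 i = dotp u (row i A).
Proof. by rewrite mxE; apply: eq_bigr => j _; rewrite !mxE. Qed.

Lemma self_dualP n (C : {vspace 'rV['F_2]_n}) v : self_dual C ->
  reflect (forall u, u \in C -> dotp u v = 0) (v \in C).
Proof.
move=> sdC; rewrite sdC unfold_in; apply: (iffP forallP) => H u.
  by move=> uC; move: (H u); rewrite uC => /eqP.
by apply/implyP => /H ->.
Qed.

Lemma self_dual_orth n (C : {vspace 'rV['F_2]_n}) u v :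
  self_dual C -> u \in C -> v \in C -> dotp u v = 0.
Proof. by move=> sdC uC /(self_dualP _ sdC); apply. Qed.

(** C is the kernel of the syndrome map u |-> (u . c_i)_i of a basis (c_i), and
    this map is onto because the c_i are independent. *)
Lemma self_dual_dim n (C : {vspace 'rV['F_2]_n}) :
  self_dual C -> (\dim C = n./2)%N.
Proof.
move=> sdC; rewrite -[LHS]doubleK; congr _./2.
pose A : 'M['F_2]_(\dim C, n) := \matrix_i (vbasis C)`_i.
have A_free : row_free A.
  apply: inj_row_free => c; rewrite mulmx_sum_row => cA.
  have /freeP free_C := basis_free (vbasisP C).
  apply/rowP => i; rewrite [RHS]mxE; apply: free_C; rewrite -[RHS]cA.
  by apply: eq_bigr => j _; rewrite rowK.
pose f := linfun (mulmxr A^T : 'rV_n -> 'rV_(\dim C)).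
have kerf : lker f = C.
  apply/vspaceP => u; rewrite memv_ker lfunE /=; apply/eqP/idP => [uA|uC].
    apply/self_dualP => // w /coord_vbasis ->.
    rewrite dotpC /dotp; under eq_bigr => j _ do rewrite summxE mulr_sumr.
    rewrite exchange_big big1 // => i _.
    transitivity (dotp u (coord (vbasis C) i w *: (vbasis C)`_i)) => //.
    have /rowP/(_ i) := uA; rewrite dotp_row rowK dotpZr mxE => ->.
    by rewrite mulr0.
  apply/rowP => i; rewrite dotp_row rowK mxE.
  by apply: (self_dual_orth sdC) => //; apply/vbasis_mem/mem_nth; rewrite size_tuple.
have imf : limg f = fullv.
  apply/eqP; rewrite eqEsubv subvf /=; apply/subvP => y _.
  have /row_freeP[B AB] := A_free.
  have -> : y = f (y *m B^T).
    by rewrite lfunE /= -mulmxA -trmx_mul AB trmx1 mulmx1.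
  exact: memv_img (memvf _).
have := limg_ker_dim f fullv; rewrite capfv kerf imf !dimvf /dim /= !mul1n.
by rewrite addnn.
Qed.

Definition perp n (v : 'rV['F_2]_n) : {vspace 'rV['F_2]_n} :=
  lker (linfun (mulmxr v^T : 'rV_n -> 'M_1)).

Lemma mem_perp n (u v : 'rV['F_2]_n) : (u \in perp v) = (dotp u v == 0).
Proof.
rewrite memv_ker lfunE /= dotp_mx; apply/eqP/eqP => [-> | uv].
  by rewrite mxE.
by apply/matrixP => i j; rewrite !ord1 uv mxE.
Qed.

(** For a self-dual D, a vector v outside D and v . v = 0, this is the neighbor
    of D that contains v. *)
Definition neighbor_of n (D : {vspace 'rV['F_2]_n}) v :=
  (D :&: perp v + <[v]>)%VS.

(** The form in which the neighbor is described by parity checks. *)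
Lemma mem_neighbor_of n (D : {vspace 'rV['F_2]_n}) v x : dotp v v = 0 ->
  x \in neighbor_of D v <-> dotp x v = 0 /\ exists e, x - e *: v \in D.
Proof.
move=> vv; split.
  case/memv_addP => u /memv_capP[uD]; rewrite mem_perp => /eqP uv.
  case=> _ /vlineP[e ->] ->; split; first by rewrite dotpDl dotpZl uv vv mulr0 addr0.
  by exists e; rewrite addrK.
case=> xv [e xD]; rewrite -(subrK (e *: v) x); apply: memv_add; last first.
  by apply/memvZ/memv_line.
by rewrite memv_cap xD mem_perp dotpBl dotpZl xv vv mulr0 subr0 eqxx.
Qed.

Lemma self_dual_nonorth n (D : {vspace 'rV['F_2]_n}) v : self_dual D ->
  v \notin D -> exists2 u, u \in D & dotp u v = 1.
Proof.
move=> sdD; rewrite sdD unfold_in => /forallPn[u].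
by rewrite negb_imply => /andP[uD /F2_neq0 uv]; exists u.
Qed.

Lemma dim_cap_perp n (D : {vspace 'rV['F_2]_n}) v : self_dual D ->
  v \notin D -> (\dim (D :&: perp v)).+1 = \dim D.
Proof.
move=> sdD vD; rewrite -(limg_ker_dim (linfun (mulmxr v^T : 'rV_n -> 'M_1)) D).
rewrite -[LHS]addn1; congr (_ + _)%N; apply/eqP; rewrite eqn_leq; apply/andP; split.
  have [u uD uv] := self_dual_nonorth sdD vD.
  rewrite lt0n dimv_eq0; apply: contra_eqN uv => /eqP img0.
  have := memv_img (linfun (mulmxr v^T : 'rV_n -> 'M_1)) uD.
  rewrite img0 memv0 lfunE /= dotp_mx => /eqP ->.
  by rewrite mxE eq_sym oner_eq0.
by have := dimvS (subvf (linfun (mulmxr v^T : 'rV_n -> 'M_1) @: D)%VS); rewrite dimvf.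
Qed.

(** If x is orthogonal to the neighbor, subtract from x the multiple e v with
    e = d0 . x, where d0 in D has d0 . v = 1: the difference is orthogonal to
    the hyperplane of D orthogonal to v and to d0, hence to D. *)
Lemma neighbor_of_neighbors n (D : {vspace 'rV['F_2]_n}) v :
  self_dual D -> dotp v v = 0 -> v \notin D ->
  neighbors D (neighbor_of D v).
Proof.
move=> sdD vv vD; have dimD := self_dual_dim sdD.
have memC := fun x => mem_neighbor_of D x vv.
split=> //.
  have [d0 d0D d0v] := self_dual_nonorth sdD vD.
  move=> x; rewrite unfold_in; apply/idP/forallP => [/memC[xv [e xD]] y|orth].
    apply/implyP => /memC[yv [e' yD]]; apply/eqP.
    have := self_dual_orth sdD yD xD.
    rewrite dotpBr !dotpBl !dotpZr !dotpZl yv vv (dotpC v) xv.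
    by rewrite !(mulr0, subr0).
  have xC y : y \in neighbor_of D v -> dotp y x = 0.
    by move=> yC; move: (orth y); rewrite yC => /eqP.
  apply/memC; split.
    rewrite dotpC; apply: xC; apply/memC; split=> //.
    by exists 1; rewrite scale1r subrr mem0v.
  exists (dotp d0 x); apply/self_dualP => // y yD.
  have : dotp (y - dotp y v *: d0) x = 0.
    apply: xC; apply/memC; split.
      by rewrite dotpBl dotpZl d0v mulr1 subrr.
    by exists 0; rewrite scale0r subr0 memvB ?memvZ.
  by rewrite dotpBl dotpZl dotpBr dotpZr [dotp d0 x * _]mulrC.
have -> : (D :&: neighbor_of D v)%VS = (D :&: perp v)%VS.
  apply/vspaceP => x; rewrite !memv_cap mem_perp.
  apply/andP/andP => -[xD]; first by case/memC => ->.
  move=> /eqP xv; split=> //; apply/memC; split=> //.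
  by exists 0; rewrite scale0r subr0.
by rewrite -dimD -(dim_cap_perp sdD vD) subn1.
Qed.

(** Any v in C outside D will do: the intersection of D and C lies in the
    hyperplane of D orthogonal to v and has the same dimension. *)
Lemma neighbors_neighbor_of n (D C : {vspace 'rV['F_2]_n}) :
  neighbors D C -> C != D ->
  exists v, [/\ v \in C, v \notin D & C = neighbor_of D v].
Proof.
case=> sdD sdC dimDC neqCD.
have [CsubD|/subvPn[v vC vD]] := boolP (C <= D)%VS.
  case/eqP: neqCD; apply/eqP; rewrite eqEsubv CsubD /=; apply/subvP => x xD.
  apply/self_dualP => // u uC; apply: (self_dual_orth sdD) => //.
  exact: subvP CsubD _ uC.
have vv := self_dual_orth sdC vC vC.
exists v; split=> //.
have DC : (D :&: C)%VS = (D :&: perp v)%VS.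
  apply/eqP; rewrite eqEdim; apply/andP; split.
    apply/subvP => x; rewrite !memv_cap mem_perp => /andP[-> xC].
    by rewrite (self_dual_orth sdC).
  rewrite dimDC -(self_dual_dim sdD) -(dim_cap_perp sdD vD).
  by rewrite subn1.
have [d0 d0D d0v] := self_dual_nonorth sdD vD.
apply/vspaceP => x; apply/idP/idP => [xC|].
  apply/mem_neighbor_of => //; split; first exact: (self_dual_orth sdC).
  exists (dotp d0 x); apply/self_dualP => // y yD.
  have : y - dotp y v *: d0 \in (D :&: C)%VS.
    rewrite DC memv_cap memvB ?memvZ //=.
    by rewrite mem_perp dotpBl dotpZl d0v mulr1 subrr.
  case/memv_capP => _ /(self_dual_orth sdC)/(_ xC).
  by rewrite dotpBl dotpZl dotpBr dotpZr [dotp d0 x * _]mulrC.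
rewrite /neighbor_of -DC => /memv_addP[u /memv_capP[_ uC] [w /vlineP[e ->] ->]].
by rewrite memvD ?memvZ.
Qed.

(** * Coordinate pairs, and the words of d_n^+ and of its neighbors *)

Lemma ev_proof m (j : 'I_m) : (j.*2 < m.*2)%N.
Proof. by rewrite ltn_double. Qed.

Lemma od_proof m (j : 'I_m) : (j.*2.+1 < m.*2)%N.
Proof. by rewrite -doubleS leq_double. Qed.

Lemma half_proof m (i : 'I_m.*2) : (i./2 < m)%N.
Proof. by have := ltn_ord i; lia. Qed.

Definition ev m (j : 'I_m) : 'I_m.*2 := Ordinal (ev_proof j).
Definition od m (j : 'I_m) : 'I_m.*2 := Ordinal (od_proof j).
Definition half_ord m (i : 'I_m.*2) : 'I_m := Ordinal (half_proof i).

Definition pair_row m (a b : 'I_m -> 'F_2) : 'rV['F_2]_m.*2 :=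
  \row_i (if odd i then b (half_ord i) else a (half_ord i)).

Lemma half_ord_ev m (j : 'I_m) : half_ord (ev j) = j.
Proof. by apply: val_inj; rewrite /= doubleK. Qed.

Lemma half_ord_od m (j : 'I_m) : half_ord (od j) = j.
Proof. by apply: val_inj; rewrite /= uphalf_double. Qed.

Lemma pair_row_ev m (a b : 'I_m -> 'F_2) j : pair_row a b 0 (ev j) = a j.
Proof. by rewrite mxE /= odd_double half_ord_ev. Qed.

Lemma pair_row_od m (a b : 'I_m -> 'F_2) j : pair_row a b 0 (od j) = b j.
Proof. by rewrite mxE /= odd_double half_ord_od. Qed.

Lemma ev_or_od m (i : 'I_m.*2) : i = ev (half_ord i) \/ i = od (half_ord i).
Proof.
case oddi: (odd i); [right|left]; apply: val_inj => /=; have := odd_double_half i;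
  by rewrite oddi ?add0n ?add1n => ->.
Qed.

Lemma row_pairP m (u v : 'rV['F_2]_m.*2) :
  (forall j, u 0 (ev j) = v 0 (ev j)) -> (forall j, u 0 (od j) = v 0 (od j)) ->
  u = v.
Proof. by move=> Hev Hod; apply/rowP => i; case: (ev_or_od i) => ->. Qed.

Lemma big_pairs (T : Type) (idx : T) (op : Monoid.law idx) m (F : 'I_m.*2 -> T) :
  \big[op/idx]_i F i = \big[op/idx]_j op (F (ev j)) (F (od j)).
Proof.
elim: m F => [|m IHm] F; first by rewrite !big_ord0.
rewrite [RHS]big_ord_recl.
transitivity (\big[op/idx]_(i < m.*2.+2) F i) => //.
rewrite !big_ord_recl Monoid.mulmA; congr (op _ _).
  by congr (op (F _) (F _)); apply: val_inj.
rewrite (IHm (fun i => F (lift ord0 (lift ord0 i)))); apply: eq_bigr => j _.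
by congr (op (F _) (F _)); apply: val_inj.
Qed.

Lemma dotp_pairs m (u v : 'rV['F_2]_m.*2) :
  dotp u v = \sum_j (u 0 (ev j) * v 0 (ev j) + u 0 (od j) * v 0 (od j)).
Proof. exact: big_pairs. Qed.

Lemma wt_sum n (u : 'rV['F_2]_n) : wt u = (\sum_i (u 0 i != 0)%R)%N.
Proof. by rewrite /wt -sum1dep_card big_mkcond; apply: eq_bigr => i _; case: eqP. Qed.

Lemma wt_pairs m (u : 'rV['F_2]_m.*2) :
  wt u = (\sum_(j < m) ((u 0 (ev j) != 0)%R + (u 0 (od j) != 0)%R))%N.
Proof. by rewrite wt_sum big_pairs. Qed.

Lemma wtD n (u v : 'rV['F_2]_n) :
  (wt (u + v) + 2 * \sum_i (u 0%R i * v 0%R i != 0)%R = wt u + wt v)%N.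
Proof.
rewrite !wt_sum big_distrr -!big_split; apply: eq_bigr => i _; rewrite mxE.
by case: (F2_cases (u 0 i)) => ->; case: (F2_cases (v 0 i)) => ->.
Qed.

Lemma dotp_natr n (u v : 'rV['F_2]_n) :
  dotp u v = (\sum_i (u 0%R i * v 0%R i != 0)%R)%N%:R.
Proof. by rewrite natr_sum; apply: eq_bigr => i _; rewrite -F2_natr. Qed.

(** The supports of orthogonal words meet in an even number of coordinates. *)
Lemma wtD_mod4 n (u v : 'rV['F_2]_n) : dotp u v = 0 ->
  (4 %| wt u)%N -> (4 %| wt v)%N -> (4 %| wt (u + v))%N.
Proof.
rewrite dotp_natr => /eqP; rewrite F2_natr_eq0; have := wtD u v.
by move: (wt _) (wt _) (wt _) (\sum_i _)%N => a b c d; lia.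
Qed.

Lemma dotpxx_wt n (u : 'rV['F_2]_n) : dotp u u = (wt u)%:R.
Proof.
rewrite dotp_natr wt_sum; congr (_%:R); apply: eq_bigr => i _.
by rewrite F2_mulxx.
Qed.

(** The words of d_n^+: b tells whether the word lies in the coset of the vector
    (1, 0, ..., 1, 0). *)
Definition dplus_word m (b : 'F_2) (y : 'rV['F_2]_m.*2) : Prop :=
  (forall j, y 0 (ev j) = y 0 (od j) + b) /\ \sum_j y 0 (od j) = 0.

Lemma dplus_wordZD m a b b' (y y' : 'rV['F_2]_m.*2) :
  dplus_word b y -> dplus_word b' y' -> dplus_word (a * b + b') (a *: y + y').
Proof.
move=> [yE y0] [y'E y'0]; split=> [j|]; first by rewrite !mxE yE y'E; ring.
transitivity (a * (\sum_j y 0 (od j)) + \sum_j y' 0 (od j)).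
  by rewrite mulr_sumr -big_split; apply: eq_bigr => j _; rewrite !mxE.
by rewrite y0 y'0 mulr0 addr0.
Qed.

Lemma dplus_word_supp m i : (1 < i < m.+1)%N ->
  dplus_word 0 (supp_row m.*2 [:: 1; 2; 2 * i - 1; 2 * i]%N).
Proof.
move=> /andP[i1 im].
have E (j : 'I_m) : (j.*2.+2 \in [:: 1; 2; 2 * i - 1; 2 * i]%N) =
    (j.*2.+1 \in [:: 1; 2; 2 * i - 1; 2 * i]%N).
  by rewrite !inE; lia.
split=> [j|]; first by rewrite !mxE addr0 /= E.
have m0 : (0 < m)%N by lia.
have i1m : (i.-1 < m)%N by lia.
rewrite (bigD1 (Ordinal m0)) //= (bigD1 (Ordinal i1m)) /=; last first.
  by rewrite -val_eqE /=; lia.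
rewrite big1 => [|j /andP[]].
  rewrite !mxE /= addr0 (_ : (i.-1).*2.+2 = 2 * i)%N; last by lia.
  by rewrite !inE eqxx !orbT; apply: F2_addxx.
rewrite -!val_eqE /= => j0 ji; rewrite mxE /= (_ : _ \in _ = false) // !inE.
by lia.
Qed.

Lemma dplus_word_alt m : dplus_word 1 (alt_row m.*2).
Proof.
split=> [j|]; first by rewrite !mxE /= odd_double /= add0r.
by rewrite big1 // => j _; rewrite mxE /= odd_double.
Qed.

(** For the converse, a word with these parities is b (1, 0, ..., 1, 0) plus the
    supports of the blocks {1, 2, 2i - 1, 2i} weighted by its entry at 2i; the
    even weight condition makes the first pair come out right. *)
Lemma mem_dplus m (y : 'rV['F_2]_m.*2) : (0 < m)%N ->
  y \in dplus m.*2 <-> exists b, dplus_word b y.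
Proof.
move=> m0; split.
  rewrite /dplus doubleK; set X := _ :: _.
  have XP x : x \in X -> exists b, dplus_word b x.
    rewrite inE => /orP[/eqP->|/mapP[i + ->]].
      by exists 1; apply: dplus_word_alt.
    by rewrite mem_index_iota => ?; exists 0; apply: dplus_word_supp.
  rewrite -[X]/(tval (in_tuple X)) => /coord_span ->.
  elim/big_ind : _ => [|u v [b ub] [b' vb']|i _].
  - by exists 0; split=> [j|]; rewrite ?mxE ?addr0 // big1 // => j _; rewrite mxE.
  - by exists (1 * b + b'); rewrite -[u]scale1r; apply: dplus_wordZD.
  have [b xb] : exists b, dplus_word b X`_i by apply/XP/mem_nth.
  exists (coord (in_tuple X) i y * b + 0); rewrite -[_ *: _]addr0.
  apply: dplus_wordZD => //.
  by split=> [j|]; rewrite ?mxE ?addr0 // big1 // => j _; rewrite mxE.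
case: m m0 y => // m _ y [b [yE y0]].
have -> : y = b *: alt_row _ +
    \sum_(k < m) y 0 (od (lift ord0 k)) *:
      supp_row _ [:: 1; 2; 2 * k.+2 - 1; 2 * k.+2]%N.
  (* c selects the first (true) or second (false) coordinate of the pair j *)
  have hit (j : 'I_m.+1) (c : bool) (i : 'I_m.+1.*2) : i = (j.*2 + ~~ c)%N :> nat ->
    (\sum_(k < m) y 0 (od (lift ord0 k)) *:
      supp_row m.+1.*2 [:: 1; 2; 2 * k.+2 - 1; 2 * k.+2]%N) 0 i = y 0 (od j).
    move=> Ei; rewrite summxE; under eq_bigr => k _ do rewrite !mxE Ei.
    have Ek (k : 'I_m) : ((j.*2 + ~~ c)%N.+1 \in [:: 1; 2; 2 * k.+2 - 1; 2 * k.+2]%N)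
        = (j == ord0) || (j == lift ord0 k).
      by rewrite -!val_eqE /= !inE /bump /=; case: c {Ei} => /=; lia.
    under eq_bigr => k _ do rewrite Ek.
    case: (unliftP ord0 j) => [k|] ->.
      rewrite (bigD1 k) //= eqxx mulr1 big1 ?addr0 // => k' k'k.
      by rewrite (inj_eq lift_inj) eq_sym (negPf k'k) mulr0.
    move: y0; rewrite big_ord_recl => /eqP; rewrite addr_eq0 F2_oppr => /eqP ->.
    by apply: eq_bigr => k _; rewrite eqxx mulr1.
  apply: row_pairP => j; rewrite [RHS]mxE [X in X + _]mxE [alt_row _ _ _]mxE.
    have -> : odd (ev j).+1 = true by rewrite /= odd_double.
    by rewrite (hit j true); [rewrite mulr1 yE addrC | rewrite /= addn0].
  have -> : odd (od j).+1 = false by rewrite /= odd_double.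
  by rewrite (hit j false); [rewrite mulr0 add0r | rewrite /= addn1].
apply: memvD; first by rewrite memvZ ?memv_span ?mem_head.
apply: memv_suml => k _; apply/memvZ/memv_span.
rewrite inE; apply/orP; right.
apply: (map_f (fun i => supp_row _ [:: 1; 2; 2 * i - 1; 2 * i]%N)).
by rewrite mem_index_iota doubleK /= !ltnS.
Qed.

Lemma dplus_word_dotp m b b' (y y' : 'rV['F_2]_m.*2) : ~~ odd m ->
  dplus_word b y -> dplus_word b' y' -> dotp y y' = 0.
Proof.
move=> m_even [yE y0] [y'E y'0]; rewrite dotp_pairs.
transitivity (b' * (\sum_j y 0 (od j)) + b * (\sum_j y' 0 (od j))
    + \sum_(j < m) b * b').
  rewrite !mulr_sumr -!big_split; apply: eq_bigr => j _; rewrite yE y'E /=.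
  by move: (b) (b') (y 0 _) (y' 0 _); F2_decide.
rewrite y0 y'0 !mulr0 !add0r sumr_const card_ord -mulr_natr.
suff /eqP -> : (m%:R == 0 :> 'F_2) by rewrite mulr0.
by rewrite F2_natr_eq0 dvdn2.
Qed.

(** Orthogonality to the doubled word supported on the pairs 0 and j shows that
    all pairs have the same sum b; orthogonality to (1, 0, ..., 1, 0) gives the
    even weight condition. *)
Lemma dplus_self_dual m : (0 < m)%N -> ~~ odd m -> self_dual (dplus m.*2).
Proof.
move=> m0 m_even x; rewrite unfold_in; apply/idP/forallP.
  move=> /(mem_dplus _ m0)[b xb] y; apply/implyP => /(mem_dplus _ m0)[b' yb'].
  by apply/eqP; apply: (dplus_word_dotp m_even yb' xb).
move=> orth.
have {}orth y b : dplus_word b y -> dotp y x = 0.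
  move=> yb; have := orth y; rewrite (_ : y \in _); first by move/eqP.
  by apply/(mem_dplus _ m0); exists b.
have altx := orth _ _ (dplus_word_alt m).
pose b := x 0 (ev (Ordinal m0)) + x 0 (od (Ordinal m0)).
have xE j : x 0 (ev j) = x 0 (od j) + b.
  have [->|j0] := eqVneq j (Ordinal m0).
    by rewrite /b addrCA F2_addxx addr0.
  pose c (i : 'I_m) : 'F_2 := ((i == j) || (i == Ordinal m0))%:R.
  have : dplus_word 0 (pair_row c c).
    split=> [i|]; first by rewrite pair_row_ev pair_row_od addr0.
    under eq_bigr => i _ do rewrite pair_row_od.
    rewrite (bigD1 j) //= (bigD1 (Ordinal m0)) 1?eq_sym //= big1.
      by rewrite /c !eqxx orbT /= addr0 F2_addxx.
    by move=> i /andP[ij i0]; rewrite /c (negPf ij) (negPf i0).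
  move/orth; rewrite dotp_pairs (bigD1 j) //= (bigD1 (Ordinal m0)) 1?eq_sym //= big1.
    rewrite !pair_row_ev !pair_row_od /c !eqxx orbT /= !mul1r addr0 -/b.
    by move/eqP; rewrite -addrA addr_eq0 F2_oppr => /eqP.
  move=> i /andP[ij i0].
  by rewrite pair_row_ev pair_row_od /c (negPf ij) (negPf i0) !mul0r addr0.
apply/(mem_dplus _ m0); exists b; split=> //.
transitivity (\sum_j x 0 (od j) + \sum_(j < m) b).
  rewrite sumr_const card_ord -[X in _ = _ + X]mulr_natr.
  suff /eqP -> : (m%:R == 0 :> 'F_2) by rewrite mulr0 addr0.
  by rewrite F2_natr_eq0 dvdn2.
rewrite -big_split -[RHS]altx dotp_pairs; apply: eq_bigr => j _.
by rewrite !mxE /= odd_double /= mul1r mul0r addr0 xE.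
Qed.

Lemma dplus_word_wt m b (y : 'rV['F_2]_m.*2) : (4 %| m)%N ->
  dplus_word b y -> (4 %| wt y)%N.
Proof.
move=> m4 [yE y0]; rewrite wt_pairs.
case: (F2_cases b) yE => -> yE.
  have : (2 %| \sum_j (y 0%R (od j) != 0)%R)%N.
    rewrite -F2_natr_eq0 natr_sum -[X in _ == X]y0; apply/eqP/eq_bigr => j _.
    by rewrite -F2_natr.
  under [in X in _ -> X]eq_bigr => j _ do rewrite yE addr0 addnn -muln2.
  by rewrite -big_distrl /=; move: (\sum_j _)%N => k; lia.
rewrite (eq_bigr (fun=> 1%N)) ?sum1_card ?card_ord // => j _.
by rewrite yE; case: (F2_cases (y 0 (od j))) => ->.
Qed.

Lemma neighbor_of_dplus_typeII m (v : 'rV['F_2]_m.*2) : (0 < m)%N ->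
  (4 %| m)%N -> (4 %| wt v)%N -> v \notin dplus m.*2 ->
  type_II (neighbor_of (dplus m.*2) v) /\
  neighbors (dplus m.*2) (neighbor_of (dplus m.*2) v).
Proof.
move=> m0 m4 v4 vD.
have sdD : self_dual (dplus m.*2) by apply: dplus_self_dual => //; lia.
have vv : dotp v v = 0 by apply/eqP; rewrite dotpxx_wt F2_natr_eq0; lia.
have nb := neighbor_of_neighbors sdD vv vD.
split=> //; split; first by case: nb.
move=> x /(mem_neighbor_of _ _ vv)[xv [e /(mem_dplus _ m0)[b xb]]].
rewrite -(subrK (e *: v) x); apply: wtD_mod4.
- by rewrite dotpBl !dotpZr dotpZl xv vv !mulr0 subrr.
- exact: dplus_word_wt xb.
case: (F2_cases e) => ->; rewrite ?scale1r // scale0r.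
by rewrite wt_sum big1 // => i _; rewrite mxE eqxx.
Qed.

Definition mixed m (v : 'rV['F_2]_m.*2) (j : 'I_m) : bool :=
  v 0 (ev j) != v 0 (od j).

Definition od_sum m (v : 'rV['F_2]_m.*2) : 'F_2 := \sum_j v 0 (od j).

Definition both_sum m (v : 'rV['F_2]_m.*2) : 'F_2 :=
  \sum_j v 0 (ev j) * v 0 (od j).

(** The parity checks satisfied by the word x = d + e v of the neighbor defined
    by v, where d is a word of d_n^+ with parameter b orthogonal to v.  The two
    sums express that the second coordinates of d have even weight and that d
    is orthogonal to v. *)
Definition neighbor_word m (v : 'rV['F_2]_m.*2) (b e : 'F_2)
    (x : 'rV['F_2]_m.*2) : Prop :=
  [/\ forall j, x 0 (ev j) = x 0 (od j) + b + e * (mixed v j)%:R,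
      \sum_(j | ~~ mixed v j) x 0 (od j) = e * both_sum v + b * od_sum v &
      \sum_(j | mixed v j) x 0 (od j)
        = e * (od_sum v + both_sum v) + b * od_sum v].

Lemma mixedE m (v : 'rV['F_2]_m.*2) j :
  (mixed v j)%:R = v 0 (ev j) + v 0 (od j).
Proof.
rewrite /mixed; case: (F2_cases (v 0 (ev j))) => ->;
  by case: (F2_cases (v 0 (od j))) => ->; apply/eqP.
Qed.

Lemma sum_mixed m (v : 'rV['F_2]_m.*2) (F : 'I_m -> 'F_2) :
  \sum_(j | mixed v j) F j = \sum_j F j * (v 0 (ev j) + v 0 (od j)).
Proof.
rewrite big_mkcond; apply: eq_bigr => j _; rewrite -mixedE.
by case: (mixed v j); rewrite ?mulr1 ?mulr0.
Qed.

(** Since v . v = 0, the first and the second coordinates of v have the same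
    sum; this turns the orthogonality x . v = 0 into the check on the mixed
    pairs. *)
Lemma neighbor_wordP m (v : 'rV['F_2]_m.*2) b e x : dotp v v = 0 ->
  neighbor_word v b e x <-> dotp x v = 0 /\ dplus_word b (x - e *: v).
Proof.
move=> vv.
have Ev : \sum_j v 0 (ev j) = od_sum v.
  apply/eqP; rewrite -subr_eq0 F2_oppr -[X in _ == X]vv dotp_pairs -big_split.
  by apply/eqP/eq_bigr => j _; rewrite !F2_mulxx.
have pairE j : x 0 (ev j) = x 0 (od j) + b + e * (mixed v j)%:R <->
    (x - e *: v) 0 (ev j) = (x - e *: v) 0 (od j) + b.
  have D : (x - e *: v) 0 (ev j) - ((x - e *: v) 0 (od j) + b) =
      x 0 (ev j) - (x 0 (od j) + b + e * (mixed v j)%:R).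
    rewrite mixedE !mxE.
    by move: (x 0 _) (x 0 _) (v 0 _) (v 0 _) (b) (e); F2_decide.
  by split=> H; apply/eqP; rewrite -subr_eq0; [rewrite D | rewrite -D]; rewrite H subrr.
have Eod : \sum_j (x - e *: v) 0 (od j) = \sum_j x 0 (od j) + e * od_sum v.
  rewrite mulr_sumr -big_split; apply: eq_bigr => j _.
  by rewrite !mxE -mulNr F2_oppr.
have Edot : (forall j, x 0 (ev j) = x 0 (od j) + b + e * (mixed v j)%:R) ->
    dotp x v = \sum_(j | mixed v j) x 0 (od j) + b * od_sum v
       + e * (od_sum v + both_sum v).
  move=> xE; rewrite sum_mixed -Ev !mulrDr !mulr_sumr -!big_split dotp_pairs.
  apply: eq_bigr => j _; rewrite xE mixedE /=.
  by move: (x 0 _) (v 0 _) (v 0 _) (b) (e); F2_decide.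
have Esplit : \sum_j x 0 (od j) = \sum_(j | mixed v j) x 0 (od j)
    + \sum_(j | ~~ mixed v j) x 0 (od j).
  exact: bigID.
split=> [[xE x0 x1]|[xv [xE xod]]].
  split.
    by rewrite Edot // x1; move: (od_sum v) (both_sum v) (b) (e); F2_decide.
  split=> [j|]; first by apply/pairE.
  rewrite Eod Esplit x0 x1.
  by move: (od_sum v) (both_sum v) (b) (e); F2_decide.
have {}xE j := (pairE j).2 (xE j).
have solve (S T o a b' e' : 'F_2) :
    0 == S + b' * o + e' * (o + a) -> S + T + e' * o == 0 ->
    (T == e' * a + b' * o) && (S == e' * (o + a) + b' * o).
  by move: S T o a b' e'; F2_decide.
move: (Edot xE) xod; rewrite xv Eod Esplit => /eqP Hx /eqP Hod.
by have /andP[/eqP ? /eqP ?] := solve _ _ _ _ _ _ Hx Hod.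
Qed.

Lemma mem_neighbor_word m (v : 'rV['F_2]_m.*2) x : (0 < m)%N -> dotp v v = 0 ->
  x \in neighbor_of (dplus m.*2) v <-> exists b e, neighbor_word v b e x.
Proof.
move=> m0 vv; split.
  case/(mem_neighbor_of _ _ vv) => xv [e /(mem_dplus _ m0)[b xb]].
  by exists b, e; apply/neighbor_wordP.
case=> b [e /(neighbor_wordP _ _ _ vv)[xv xb]].
apply/mem_neighbor_of => //; split=> //; exists e.
by apply/(mem_dplus _ m0); exists b.
Qed.

Lemma neighbor_word_inj m (v : 'rV['F_2]_m.*2) x b e b' e' : (0 < m)%N ->
  dotp v v = 0 -> v \notin dplus m.*2 ->
  neighbor_word v b e x -> neighbor_word v b' e' x -> b = b' /\ e = e'.
Proof.
move=> m0 vv vD xbe xbe'.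
have ee' : e = e'.
  have [_ xb] := (neighbor_wordP _ _ _ vv).1 xbe.
  have [_ xb'] := (neighbor_wordP _ _ _ vv).1 xbe'.
  have : (e' - e) *: v \in dplus m.*2.
    have -> : (e' - e) *: v = (x - e *: v) - (x - e' *: v).
      by rewrite scalerBl opprB [RHS]addrC addrA subrK.
    by apply: memvB; apply/(mem_dplus _ m0); [exists b | exists b'].
  have [/eqP|/F2_neq0 ->] := eqVneq (e' - e) 0.
    by rewrite subr_eq0 => /eqP.
  by rewrite scale1r (negPf vD).
split=> //; case: xbe xbe' => /(_ (Ordinal m0)) xE _ _ [/(_ (Ordinal m0))] + _ _.
by rewrite xE ee' => /addIr/addrI.
Qed.

Lemma wt_mixed m (v : 'rV['F_2]_m.*2) :
  wt v = (#|[pred j | mixed v j]| +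
    2 * \sum_(j < m) (v 0%R (ev j) * v 0%R (od j) != 0)%R)%N.
Proof.
rewrite wt_pairs -sum1_card [X in (_ = X + _)%N]big_mkcond big_distrr.
rewrite -big_split /=; apply: eq_bigr => j _; rewrite inE /mixed.
by move: (v 0 _) (v 0 _); F2_decide.
Qed.

Lemma card_mixed_mod4 m (v : 'rV['F_2]_m.*2) : (4 %| wt v)%N ->
  (4 %| #|[pred j | mixed v j]| + 2 * (both_sum v != 0)%R)%N.
Proof.
rewrite wt_mixed; set G := (\sum_j _)%N.
have : (both_sum v == 0) = (2 %| G)%N.
  rewrite -F2_natr_eq0 natr_sum; congr (_ == 0).
  by apply: eq_bigr => j _; rewrite -F2_natr.
by case: (both_sum v == 0); lia.
Qed.

(** Take v = (1,0) on t pairs, (1,1) on one further pair and (0,0) elsewhere; its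
    weight is t + 2.  It is not in d_n^+ because its pairs do not all have the
    same sum. *)
Lemma neighbor_vector_exists m s t : m = (s + t)%N -> (s %% 4 = 2)%N ->
  (t %% 4 = 2)%N ->
  exists v : 'rV['F_2]_m.*2, [/\ (4 %| wt v)%N, v \notin dplus m.*2,
    both_sum v = 1 & #|[pred j | mixed v j]| = t].
Proof.
move=> Em s4 t4.
pose l := m.-1.
pose v : 'rV['F_2]_m.*2 := pair_row (fun j : 'I_m => ((j < t) || (j == l :> nat))%N%:R)
  (fun j : 'I_m => (j == l :> nat)%:R).
have m0 : (0 < m)%N by lia.
have lm : (l < m)%N by rewrite /l; lia.
have mixv j : mixed v j = (j < t)%N.
  rewrite /mixed pair_row_ev pair_row_od.
  have : ~~ ((j < t) && (j == l :> nat))%N by rewrite /l; lia.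
  by case: (j < t)%N; case: (j == l :> nat).
have both j : v 0 (ev j) * v 0 (od j) = (j == l :> nat)%:R.
  by rewrite pair_row_ev pair_row_od; case: (j == l :> nat); rewrite ?orbT ?mulr1 ?mulr0.
have cardv : #|[pred j | mixed v j]| = t.
  have le_tm : (t <= m)%N by lia.
  rewrite -sum1_card (eq_bigl (fun j : 'I_m => j < t)%N) //.
  by rewrite (big_ord_narrow le_tm) sum1_card card_ord.
exists v; split=> //.
- rewrite wt_mixed cardv (bigD1 (Ordinal lm)) //= both eqxx big1 => [|j jl].
    by rewrite oner_eq0 /=; lia.
  by rewrite both -val_eqE /= in jl *; rewrite (negPf jl) eqxx.
- apply/negP => /(mem_dplus _ m0)[b [vE _]].
  have := vE (Ordinal m0); have := vE (Ordinal lm).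
  rewrite !pair_row_ev !pair_row_od /= eqxx orbT.
  have -> : (0 < t)%N = true by lia.
  have -> : (0 == l)%N = false by rewrite /l; lia.
  by case: (F2_cases b) => -> /eqP + /eqP.
rewrite /both_sum (bigD1 (Ordinal lm)) //= both eqxx big1 ?addr0 // => j jl.
by rewrite both -val_eqE /= in jl *; rewrite (negPf jl).
Qed.

(** * Fourier analysis of the weight enumerators *)

(** The nontrivial character of F_2. *)
Definition sgn (A : comNzRingType) (x : 'F_2) : A := (-1) ^+ (x : nat).

Lemma sgn0 (A : comNzRingType) : sgn A 0 = 1. Proof. by []. Qed.
Lemma sgn1 (A : comNzRingType) : sgn A 1 = -1. Proof. by []. Qed.

Lemma sgnD (A : comNzRingType) x y : sgn A (x + y) = sgn A x * sgn A y.
Proof.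
have E : sgn A (1 + 1) = 1 by rewrite F2_addxx.
case: (F2_cases x) (F2_cases y) => -> [] ->;
  by rewrite ?E ?add0r ?addr0 ?sgn0 ?sgn1 ?mul1r ?mulr1 ?mulrNN ?mulr1.
Qed.

Lemma sgn_sum (A : comNzRingType) (I : finType) (F : I -> 'F_2) :
  sgn A (\sum_i F i) = \prod_i sgn A (F i).
Proof. by apply: (big_morph _ (@sgnD A) (sgn0 A)). Qed.

Definition cdot g (a c : 'cV['F_2]_g) : 'F_2 := (a^T *m c) 0 0.

Lemma cdotDr g (a c c' : 'cV['F_2]_g) : cdot a (c + c') = cdot a c + cdot a c'.
Proof. by rewrite /cdot mulmxDr mxE. Qed.

Lemma cdotDl g (a a' c : 'cV['F_2]_g) : cdot (a + a') c = cdot a c + cdot a' c.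
Proof. by rewrite /cdot linearD mulmxDl mxE. Qed.

Lemma cdotZr g k (a c : 'cV['F_2]_g) : cdot a (k *: c) = k * cdot a c.
Proof. by rewrite /cdot -scalemxAr mxE. Qed.

Lemma cdot_sumr g (a : 'cV['F_2]_g) (I : finType) (P : pred I) F :
  cdot a (\sum_(i | P i) F i) = \sum_(i | P i) cdot a (F i).
Proof. by rewrite /cdot mulmx_sumr summxE. Qed.

Lemma cdot_delta g (k : 'I_g) (c : 'cV['F_2]_g) :
  cdot (delta_mx k 0) c = c k 0.
Proof. by rewrite /cdot trmx_delta -rowE mxE. Qed.

Lemma cV_addxx g (a : 'cV['F_2]_g) : a + a = 0.
Proof. by apply/colP => k; rewrite !mxE F2_addxx. Qed.

Lemma cV_addKr g (a c : 'cV['F_2]_g) : c + a + a = c.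
Proof. by rewrite -addrA cV_addxx addr0. Qed.

Lemma eqN_alg_eq0 (K : numFieldType) (A : lmodType K) (x : A) : x = - x -> x = 0.
Proof.
move=> xN; have x2 : 2%:R *: x = 0 by rewrite scaler_nat mulr2n {1}xN addNr.
by move/eqP: x2; rewrite scaler_eq0 pnatr_eq0 => /eqP.
Qed.

(** If r has a nonzero coordinate k, translating x by the k-th basis vector
    changes the sign of the sum. *)
Lemma sum_sgn_cdot (K : numFieldType) (A : comAlgType K) g (r : 'cV['F_2]_g) :
  \sum_(x : 'cV['F_2]_g) sgn A (cdot x r) = (r == 0)%:R *+ 2 ^ g.
Proof.
have [->|/eqP/colP r0] := eqVneq r 0.
  under eq_bigr => x _ do rewrite /cdot mulmx0 mxE sgn0.
  by rewrite sumr_const card_mx card_Fp // muln1.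
have /existsP[k rk] : [exists k, r k 0 != 0].
  by apply/existsPn => r_0; apply: r0 => k; apply/eqP; rewrite mxE -[_ == _]negbK r_0.
rewrite mul0rn; apply: (@eqN_alg_eq0 K).
rewrite -mulN1r mulr_sumr (reindex_inj (addIr (delta_mx k 0))) /=.
apply: eq_bigr => x _; rewrite cdotDl cdot_delta (F2_neq0 rk) sgnD sgn1.
by rewrite mulrC.
Qed.

(** Both constraints on c are detected by character sums; for fixed characters
    the sum over c then factors over the positions. *)
Lemma fourier_two (K : numFieldType) (A : comAlgType K) g m (w : pred 'I_m)
    (F : 'I_m -> 'cV['F_2]_g -> A) (r r' : 'cV['F_2]_g) :
  (\sum_(c : {ffun 'I_m -> 'cV['F_2]_g} |
      (\sum_(j | ~~ w j) c j == r) && (\sum_(j | w j) c j == r'))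
    \prod_j F j (c j)) *+ (2 ^ g * 2 ^ g) =
  \sum_x \sum_y sgn A (cdot x r + cdot y r') *
    \prod_j \sum_a sgn A (cdot (if w j then y else x) a) * F j a.
Proof.
have expand x y : sgn A (cdot x r + cdot y r') *
    (\prod_j \sum_a sgn A (cdot (if w j then y else x) a) * F j a) =
    \sum_(c : {ffun 'I_m -> 'cV['F_2]_g})
      sgn A (cdot x (r + \sum_(j | ~~ w j) c j)) *
      sgn A (cdot y (r' + \sum_(j | w j) c j)) * \prod_j F j (c j).
  rewrite bigA_distr_bigA mulr_sumr; apply: eq_bigr => c _.
  rewrite big_split /= mulrA -sgn_sum -!sgnD; congr (sgn A _ * _).
  rewrite !cdotDr !cdot_sumr addrACA; congr (_ + _).
  rewrite [LHS](bigID w) /= addrC.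
  by congr (_ + _); apply: eq_bigr => j wj; rewrite ?wj ?(negPf wj).
rewrite [RHS](eq_bigr _ (fun x _ => eq_bigr _ (fun y _ => expand x y))).
under eq_bigr => x _ do rewrite exchange_big /=.
rewrite exchange_big /= -sumrMnl big_mkcond; apply: eq_bigr => c _.
transitivity ((\sum_x sgn A (cdot x (r + \sum_(j | ~~ w j) c j))) *
  (\sum_y sgn A (cdot y (r' + \sum_(j | w j) c j))) * \prod_j F j (c j));
  last first.
  by rewrite !mulr_suml; apply: eq_bigr => x _; rewrite mulr_sumr mulr_suml.
rewrite !(sum_sgn_cdot A).
have eq0 (a b : 'cV['F_2]_g) : (a + b == 0) = (b == a).
  by rewrite -(inj_eq (addIr b)) cV_addKr add0r eq_sym.
rewrite !eq0; case: (_ == r) => /=; last by rewrite mul0rn !mul0r.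
case: (_ == r') => /=; last by rewrite mul0rn mulr0 mul0r.
by rewrite -natrM mulr_natl.
Qed.

Definition xvar (K : numFieldType) g (a : 'cV['F_2]_g) :
  {mpoly K[#|{: 'cV['F_2]_g}|]} := 'X_(enum_rank a).

(** For h = (b, x) this is the polynomial which becomes the square of the theta
    constant with characteristic h when the X_a are replaced by the theta
    constants of second order. *)
Definition theta_sq (K : numFieldType) g (h : 'cV['F_2]_g * 'cV['F_2]_g) :
    {mpoly K[#|{: 'cV['F_2]_g}|]} :=
  \sum_a sgn _ (cdot h.2 a) * (xvar K (a + h.1) * xvar K a).

Definition qform g (h : 'cV['F_2]_g * 'cV['F_2]_g) : 'F_2 := cdot h.2 h.1.

(** The substitution a |-> a + b exchanges the two variables of each term. *)
Lemma theta_sq_odd (K : numFieldType) g (h : 'cV['F_2]_g * 'cV['F_2]_g) :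
  qform h = 1 -> theta_sq K h = 0.
Proof.
move=> qh; apply: (@eqN_alg_eq0 K).
rewrite -mulN1r {2}/theta_sq mulr_sumr /theta_sq (reindex_inj (addIr h.1)) /=.
apply: eq_bigr => a _; rewrite cV_addKr cdotDr -/(qform h) qh sgnD sgn1.
by rewrite [xvar K a * _]mulrC [sgn _ _ * -1]mulrC -mulrA.
Qed.

Lemma sgn_theta_sq (K : numFieldType) g (h : 'cV['F_2]_g * 'cV['F_2]_g) k s :
  (0 < s)%N -> sgn _ (k * qform h) * theta_sq K h ^+ s = theta_sq K h ^+ s.
Proof.
case: s => // s _; case: (F2_cases (qform h)) => qh.
  by rewrite qh mulr0 sgn0 mul1r.
by rewrite theta_sq_odd // exprS mul0r mulr0.
Qed.

Definition col_of g n (u : {ffun 'I_g -> 'rV['F_2]_n}) (i : 'I_n) :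
  'cV['F_2]_g := \col_(k < g) u k 0 i.

(** The exponent of X_a counts the columns equal to a. *)
Lemma wt_enum_cols (K : numFieldType) g n (C : {vspace 'rV['F_2]_n}) :
  wt_enum K g C = \sum_(u : {ffun 'I_g -> 'rV['F_2]_n} | [forall k, u k \in C])
    \prod_i xvar K (col_of u i).
Proof.
apply: eq_bigr => u _.
rewrite (partition_big (col_of u) predT) //=; apply: eq_bigr => a _.
rewrite (eq_bigr (fun=> xvar K a)) => [|i /eqP -> //].
by rewrite prodr_const /col_count cardsE.
Qed.

(** Row k is the word with parameters b_k and e_k and second coordinates
    (c_j)_k. *)
Definition word_rows g m (v : 'rV['F_2]_m.*2) (b e : 'cV['F_2]_g)
    (c : {ffun 'I_m -> 'cV['F_2]_g}) : {ffun 'I_g -> 'rV['F_2]_m.*2} :=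
  [ffun k => pair_row (fun j => c j k 0 + b k 0 + e k 0 * (mixed v j)%:R)
                      (fun j => c j k 0)].

Definition word_cond g m (v : 'rV['F_2]_m.*2) (b e : 'cV['F_2]_g)
    (c : {ffun 'I_m -> 'cV['F_2]_g}) : bool :=
  (\sum_(j | ~~ mixed v j) c j == both_sum v *: e + od_sum v *: b) &&
  (\sum_(j | mixed v j) c j == (od_sum v + both_sum v) *: e + od_sum v *: b).

Lemma word_rowsP g m (v : 'rV['F_2]_m.*2) (b e : 'cV['F_2]_g) c k :
  word_cond v b e c -> neighbor_word v (b k 0) (e k 0) (word_rows v b e c k).
Proof.
move=> /andP[/eqP/colP/(_ k) c0 /eqP/colP/(_ k) c1]; rewrite ffunE.
split=> [j||].
- by rewrite pair_row_ev pair_row_od.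
- under eq_bigr => j _ do rewrite pair_row_od.
  by move: c0; rewrite summxE !mxE => ->; rewrite mulrC [od_sum v * _]mulrC.
under eq_bigr => j _ do rewrite pair_row_od.
by move: c1; rewrite summxE !mxE => ->; rewrite mulrC [od_sum v * _]mulrC.
Qed.

Lemma word_rows_surj g m (v : 'rV['F_2]_m.*2) (b e : 'cV['F_2]_g)
    (u : {ffun 'I_g -> 'rV['F_2]_m.*2}) :
  (forall k, neighbor_word v (b k 0) (e k 0) (u k)) ->
  let c := [ffun j => col_of u (od j)] in
  word_cond v b e c /\ u = word_rows v b e c.
Proof.
move=> uP c; have cE j k : c j k 0 = u k 0 (od j) by rewrite ffunE mxE.
split.
  apply/andP; split; apply/eqP/colP => k; have [_ u0 u1] := uP k;
    rewrite summxE !mxE; under eq_bigr => j _ do rewrite cE;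
    by rewrite ?u0 ?u1 mulrC [od_sum v * _]mulrC.
apply/ffunP => k; rewrite ffunE; apply: row_pairP => j.
  by rewrite pair_row_ev cE; have [-> _ _] := uP k.
by rewrite pair_row_od cE.
Qed.

(** The tuples of words are parametrized by (b, e, c).  The predicate okE allows
    for both uses: every e is admitted for a neighbor, and only e = 0 for d_n^+,
    which is described by v = 0. *)
Lemma wt_enum_words (K : numFieldType) g m (C : {vspace 'rV['F_2]_m.*2})
    (v : 'rV['F_2]_m.*2) (okE : pred 'F_2) :
  (forall x, x \in C <-> exists b e, okE e /\ neighbor_word v b e x) ->
  (forall x b e b' e', okE e -> okE e' -> neighbor_word v b e x ->
    neighbor_word v b' e' x -> b = b' /\ e = e') ->
  wt_enum K g C =
  \sum_b \sum_(e : 'cV['F_2]_g | [forall k, okE (e k 0)])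
    \sum_(c | word_cond v b e c)
      \prod_j (xvar K (c j + b + (mixed v j)%:R *: e) * xvar K (c j)).
Proof.
move=> memC injC; rewrite wt_enum_cols.
pose T := ('cV['F_2]_g * 'cV['F_2]_g * {ffun 'I_m -> 'cV['F_2]_g})%type.
pose h (p : T) := word_rows v p.1.1 p.1.2 p.2.
pose D := [set p : T | [forall k, okE (p.1.2 k 0)] && word_cond v p.1.1 p.1.2 p.2].
have imD (u : {ffun 'I_g -> 'rV['F_2]_m.*2}) :
    [forall k, u k \in C] = (u \in [set h p | p in D]).
  apply/forallP/imsetP => [uC|[[[b e] c] + -> k]]; last first.
    rewrite inE /= => /andP[/forallP ok /word_rowsP cP].
    by apply/memC; exists (b k 0), (e k 0).
  have uP k : exists p : 'F_2 * 'F_2, okE p.2 /\ neighbor_word v p.1 p.2 (u k).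
    by have /memC[b [e ok]] := uC k; exists (b, e).
  have [f fP] := fin_all_exists uP.
  pose b : 'cV['F_2]_g := \col_k (f k).1; pose e : 'cV['F_2]_g := \col_k (f k).2.
  have [|cond ->] := @word_rows_surj g m v b e u.
    by move=> k; rewrite !mxE; have [] := fP k.
  exists (b, e, [ffun j => col_of u (od j)]) => //; rewrite inE /= cond andbT.
  by apply/forallP => k; rewrite mxE; have [] := fP k.
have injh : {in D &, injective h}.
  move=> [[b e] c] [[b' e'] c']; rewrite !inE /= => /andP[/forallP ok cond].
  move=> /andP[/forallP ok' cond'] hh.
  have row_eq k : word_rows v b e c k = word_rows v b' e' c' k.
    by have := congr1 (fun u : {ffun _ -> _} => u k) hh.
  have be k : b k 0 = b' k 0 /\ e k 0 = e' k 0.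
    have w1 := word_rowsP k cond; have w2 := word_rowsP k cond'.
    by rewrite -row_eq in w2; apply: injC w1 w2.
  congr (_, _, _).
  - by apply/colP => k; have [] := be k.
  - by apply/colP => k; have [] := be k.
  apply/ffunP => j; apply/colP => k.
  by have := congr1 (fun x : 'rV_ _ => x 0 (od j)) (row_eq k);
    rewrite !ffunE !pair_row_od.
rewrite (eq_bigl _ _ imD) big_imset //= pair_big_dep /= pair_big_dep /=.
rewrite (eq_bigl (fun p : T =>
    [forall k, okE (p.1.2 k 0)] && word_cond v p.1.1 p.1.2 p.2)); last first.
  by move=> p; rewrite inE.
apply: eq_bigr => -[[b e] c] _ /=; rewrite big_pairs; apply: eq_bigr => j _ /=.
congr (xvar K _ * xvar K _); apply/colP => k; rewrite !mxE ffunE.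
  by rewrite pair_row_ev [_ * e k 0]mulrC.
by rewrite pair_row_od.
Qed.

(** At a pair that is not mixed the inner sum over columns is theta(b, x), at a
    mixed pair it is theta(b + e, y). *)
Lemma word_sum_fourier (K : numFieldType) g m (v : 'rV['F_2]_m.*2)
    (b e : 'cV['F_2]_g) :
  (\sum_(c | word_cond v b e c)
      \prod_j (xvar K (c j + b + (mixed v j)%:R *: e) * xvar K (c j)))
    *+ (2 ^ g * 2 ^ g) =
  \sum_x \sum_y
    sgn _ (cdot x (both_sum v *: e + od_sum v *: b) +
           cdot y ((od_sum v + both_sum v) *: e + od_sum v *: b)) *
    (theta_sq K (b, x) ^+ #|[pred j | ~~ mixed v j]| *
     theta_sq K (b + e, y) ^+ #|[pred j | mixed v j]|).
Proof.
rewrite (fourier_two (mixed v)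
  (fun j a => xvar K (a + b + (mixed v j)%:R *: e) * xvar K a)).
apply: eq_bigr => x _; apply: eq_bigr => y _; congr (_ * _).
rewrite [LHS](bigID (mixed v)) [RHS]mulrC; congr (_ * _).
  rewrite (eq_bigr (fun=> theta_sq K (b + e, y))) ?prodr_const // => j /= mj.
  by apply: eq_bigr => a _; rewrite mj scale1r addrA.
rewrite (eq_bigr (fun=> theta_sq K (b, x))) ?prodr_const // => j /= mj.
by apply: eq_bigr => a _; rewrite (negPf mj) scale0r addr0.
Qed.

(** * The ring of weight enumerators *)

Lemma wt_enum_dplus (K : numFieldType) g m : (0 < m)%N ->
  wt_enum K g (dplus m.*2) *+ (2 ^ g * 2 ^ g) =
  (\sum_h theta_sq K h ^+ m) *+ 2 ^ g.
Proof.
move=> m0; pose v : 'rV['F_2]_m.*2 := 0.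
have mix0 (j : 'I_m) : mixed v j = false by rewrite /mixed !mxE eqxx.
have od0 : od_sum v = 0 by rewrite /od_sum big1 // => j _; rewrite mxE.
have both0 : both_sum v = 0 by rewrite /both_sum big1 // => j _; rewrite mxE mul0r.
have dot0 (x : 'rV['F_2]_m.*2) : dotp x v = 0.
  by rewrite /dotp big1 // => i _; rewrite mxE mulr0.
have wordE x b e : neighbor_word v b e x <-> dplus_word b x.
  rewrite (neighbor_wordP _ _ _ (dot0 v)) scaler0 subr0.
  by split=> [[]|].
rewrite (@wt_enum_words K g m _ v (pred1 0)).
- have E0 (e : 'cV['F_2]_g) : [forall k, pred1 0 (e k 0)] = (e == 0).
    apply/forallP/eqP => [e0|-> k]; last by rewrite /= mxE.
    by apply/colP => k; rewrite mxE; apply/eqP/e0.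
  rewrite -sumrMnl -(pair_bigA _ (fun b x => theta_sq K (b, x) ^+ m)) /= -sumrMnl.
  apply: eq_bigr => b _.
  rewrite (big_pred1 0); last by move=> e; rewrite E0.
  rewrite word_sum_fourier both0 od0 !addr0 !scale0r !addr0 -sumrMnl.
  apply: eq_bigr => x _.
  rewrite (eq_bigr (fun=> theta_sq K (b, x) ^+ m)) => [|y _].
    by rewrite sumr_const; congr (_ *+ _); rewrite card_mx card_Fp // muln1.
  have -> : cdot x 0 + cdot y 0 = 0 by rewrite /cdot !mulmx0 !mxE addr0.
  rewrite sgn0 mul1r.
  rewrite (_ : #|[pred j | mixed v j]| = 0%N); last first.
    by apply: eq_card0 => j; rewrite inE mix0.
  rewrite expr0 mulr1 (_ : #|[pred j | ~~ mixed v j]| = m) //.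
  by rewrite -[RHS]card_ord; apply: eq_card => j; rewrite inE mix0.
- move=> x; rewrite (mem_dplus _ m0); split=> [[b xb]|[b [e [_ xbe]]]].
    by exists b, 0; rewrite /= eqxx wordE.
  by exists b; apply: (wordE x b e).1 xbe.
move=> x b e b' e' /eqP -> /eqP -> [xE _ _] [xE' _ _]; split=> //.
have := xE (Ordinal m0); rewrite xE' => /addIr/addrI.
by [].
Qed.

(** Substitute e = b + b' in the Fourier expansion, so that h = (b, x) and
    h' = (b', y) vary independently; the sign becomes a combination of values of
    the quadratic form. *)
Lemma wt_enum_neighbor (K : numFieldType) g m (v : 'rV['F_2]_m.*2) :
  (0 < m)%N -> dotp v v = 0 -> v \notin dplus m.*2 ->
  wt_enum K g (neighbor_of (dplus m.*2) v) *+ (2 ^ g * 2 ^ g) =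
  \sum_h \sum_h'
    sgn _ (od_sum v * (qform h + qform h') + both_sum v * qform (h + h')) *
    (theta_sq K h ^+ #|[pred j | ~~ mixed v j]| *
     theta_sq K h' ^+ #|[pred j | mixed v j]|).
Proof.
move=> m0 vv vD.
rewrite (@wt_enum_words K g m _ v predT); first last.
- by move=> x b e b' e' _ _; apply: neighbor_word_inj.
- move=> x; rewrite (mem_neighbor_word _ m0 vv).
  by split=> [[b [e xw]]|[b [e [_ xw]]]]; exists b, e.
rewrite -sumrMnl.
rewrite -(pair_bigA _ (fun b x => \sum_h' sgn _ (od_sum v * (qform (b, x) + qform h') +
  both_sum v * qform ((b, x) + h')) *
    (theta_sq K (b, x) ^+ #|[pred j | ~~ mixed v j]| *
     theta_sq K h' ^+ #|[pred j | mixed v j]|))) /=.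
apply: eq_bigr => b _; rewrite -sumrMnl.
under [LHS]eq_bigr => e _ do rewrite word_sum_fourier.
rewrite (eq_bigl predT); last by move=> e; apply/forallP.
rewrite exchange_big /=; apply: eq_bigr => x _.
rewrite (reindex_inj (addrI b)) /=.
rewrite -(pair_bigA _ (fun b' y => sgn _ (od_sum v * (qform (b, x) + qform (b', y)) +
  both_sum v * qform ((b, x) + (b', y))) *
    (theta_sq K (b, x) ^+ #|[pred j | ~~ mixed v j]| *
     theta_sq K (b', y) ^+ #|[pred j | mixed v j]|))) /=.
apply: eq_bigr => b' _; apply: eq_bigr => y _.
rewrite addrA cV_addxx add0r; congr (sgn _ _ * _).
rewrite /qform (_ : (b, x) + (b', y) = (b + b', x + y)) //=.
rewrite !scalerDr !cdotDr !cdotDl !cdotZr.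
by move: (cdot _ _) (cdot _ _) (cdot _ _) (cdot _ _) (od_sum v) (both_sum v); F2_decide.
Qed.

(** The factors (-1)^q(h) and (-1)^q(h') disappear, since theta(h) = 0 when
    q(h) = 1. *)
Lemma wt_enum_neighbor_odd (K : numFieldType) g m (v : 'rV['F_2]_m.*2) :
  (0 < m)%N -> dotp v v = 0 -> v \notin dplus m.*2 -> both_sum v = 1 ->
  (0 < #|[pred j | ~~ mixed v j]|)%N -> (0 < #|[pred j | mixed v j]|)%N ->
  wt_enum K g (neighbor_of (dplus m.*2) v) *+ (2 ^ g * 2 ^ g) =
  \sum_(h : 'cV['F_2]_g * 'cV['F_2]_g) \sum_(h' : 'cV['F_2]_g * 'cV['F_2]_g)
    sgn _ (qform (h + h')) *
    (theta_sq K h ^+ #|[pred j | ~~ mixed v j]| *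
     theta_sq K h' ^+ #|[pred j | mixed v j]|).
Proof.
move=> m0 vv vD Ev s0 t0; rewrite wt_enum_neighbor // Ev.
apply: eq_bigr => h _; apply: eq_bigr => h' _.
by rewrite mul1r sgnD mulrDr sgnD mulrAC mulrACA !sgn_theta_sq // mulrC.
Qed.

Definition theta4 (K : numFieldType) g (h : 'cV['F_2]_g * 'cV['F_2]_g) :=
  theta_sq K h ^+ 4.

Definition theta_form (K : numFieldType) g (h h' : 'cV['F_2]_g * 'cV['F_2]_g) :=
  sgn _ (qform (h + h')) * (theta_sq K h ^+ 2 * theta_sq K h' ^+ 2).

Lemma form_sumE (K : numFieldType) g i j :
  \sum_h \sum_h' @theta_form K g h h' * theta4 K h ^+ i * theta4 K h' ^+ j =
  \sum_(h : 'cV['F_2]_g * 'cV['F_2]_g) \sum_(h' : 'cV['F_2]_g * 'cV['F_2]_g)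
    sgn _ (qform (h + h')) * (theta_sq K h ^+ (4 * i + 2) * theta_sq K h' ^+ (4 * j + 2)).
Proof.
apply: eq_bigr => h _; apply: eq_bigr => h' _.
by rewrite /theta_form /theta4 -!exprM !exprD; ring.
Qed.

(** The exponent 0 corresponds to a vector v all of whose pairs are mixed, or
    none; the sum is then an integer. *)
Lemma power_sum_subalg (K : numFieldType) g
    (S : {mpoly K[#|{: 'cV['F_2]_g}|]} -> Prop) k s :
  (forall s', (0 < s')%N -> (4 %| s')%N ->
    subalg_gen S (\sum_h theta_sq K h ^+ s')) ->
  (4 %| s)%N ->
  subalg_gen S (\sum_(h : 'cV['F_2]_g * 'cV['F_2]_g)
    sgn _ (k * qform h) * theta_sq K h ^+ s).
Proof.
move=> SP s4; case: (posnP s) => [->|s0]; last first.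
  by under eq_bigr => h _ do rewrite sgn_theta_sq //; apply: SP.
apply: subalg_sum => h _; rewrite expr0 mulr1.
case: (F2_cases (k * qform h)) => ->; first exact: (subalg_natr S 1).
exact/subalgN/(subalg_natr S 1).
Qed.

(** With the quadratic form q, the sum over the pairs (h, h') factors when the
    sum of products of paired coordinates of v is 0, and is one of the bilinear
    forms when it is 1. *)
Lemma frakA_power_forms (K : numFieldType) (g : nat) p :
  frakA p <-> subalg_gen (power_form_gen (@theta4 K g) (@theta_form K g)) p.
Proof.
set G := power_form_gen _ _.
have N0 : (0 < 2 ^ g * 2 ^ g)%N by rewrite muln_gt0 expn_gt0.
have GP s : (0 < s)%N -> (4 %| s)%N ->
    subalg_gen G (\sum_(h : 'cV['F_2]_g * 'cV['F_2]_g) theta_sq K h ^+ s).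
  move=> s0 /dvdnP[k Es]; apply: SubalgGen; left; exists k.-1.
  apply: eq_bigr => h _; rewrite /theta4 -exprM; congr (_ ^+ _).
  by lia.
split; apply: subalg_trans => {}p.
  case=> n [C [n0 /dvdnP[k En] CP ->]].
  have {En} : exists m, n = m.*2 /\ (4 %| m)%N by exists (4 * k)%N; lia.
  case=> m [En m4]; subst n; have m0 : (0 < m)%N by lia.
  have Wd : subalg_gen G (wt_enum K g (dplus m.*2)).
    apply: (subalg_divn N0); rewrite wt_enum_dplus // -scaler_nat.
    by apply: subalgZ; apply: GP.
  case: CP => [->//|[[sdC C4] nb]].
  have [->//|neq] := eqVneq C (dplus m.*2).
  have [v [vC vD EC]] := neighbors_neighbor_of nb neq.
  have vv := self_dual_orth sdC vC vC.
  have mix4 := card_mixed_mod4 (C4 _ vC).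
  have card_m : (#|[pred j | mixed v j]| + #|[pred j | ~~ mixed v j]| = m)%N.
    by rewrite -[RHS]card_ord -(cardC [pred j | mixed v j]).
  apply: (subalg_divn N0); rewrite {}EC.
  case: (F2_cases (both_sum v)) mix4 => Eb; rewrite Eb ?eqxx ?oner_eq0 /= => mix4.
    rewrite wt_enum_neighbor // Eb.
    under eq_bigr => h _.
      under eq_bigr => h' _ do rewrite mul0r addr0 mulrDr sgnD mulrACA.
      rewrite -mulr_sumr.
    over.
    by rewrite -mulr_suml; apply: SubalgMul; apply: power_sum_subalg => //; lia.
  rewrite wt_enum_neighbor_odd //; [|lia|lia].
  apply: SubalgGen; right.
  exists (#|[pred j | ~~ mixed v j]| %/ 4)%N, (#|[pred j | mixed v j]| %/ 4)%N.
  rewrite form_sumE; apply: eq_bigr => h _; apply: eq_bigr => h' _.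
  by congr (_ * (_ ^+ _ * _ ^+ _)); lia.
case=> [[k ->]|[i [j ->]]].
  have m0 : (0 < 4 * k.+1)%N by lia.
  apply: (@subalg_divn _ _ _ (2 ^ g)); first by rewrite expn_gt0.
  have -> : \sum_h @theta4 K g h ^+ k.+1 =
      \sum_(h : 'cV['F_2]_g * 'cV['F_2]_g) theta_sq K h ^+ (4 * k.+1).
    by apply: eq_bigr => h _; rewrite exprM.
  rewrite -wt_enum_dplus // -scaler_nat; apply/subalgZ/SubalgGen.
  exists (4 * k.+1)%N.*2, (dplus (4 * k.+1)%N.*2).
  by split=> //; [rewrite -mul2n mulnA dvdn_mulr | left].
rewrite form_sumE; set s := (4 * i + 2)%N; set t := (4 * j + 2)%N.
have [||v [v4 vD Eb Et]] := @neighbor_vector_exists (s + t)%N s t erefl.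
- by rewrite /s; lia.
- by rewrite /t; lia.
have m0 : (0 < s + t)%N by lia.
have Es : #|[pred j | ~~ mixed v j]| = s.
  have := cardC [pred j | mixed v j]; rewrite card_ord Et.
  rewrite (_ : #|[predC _]| = #|[pred j | ~~ mixed v j]|) //.
  by lia.
have vv : dotp v v = 0 by apply/eqP; rewrite dotpxx_wt F2_natr_eq0; lia.
have st4 : (4 %| s + t)%N by lia.
have [C2 nb] := neighbor_of_dplus_typeII m0 st4 v4 vD.
have := @wt_enum_neighbor_odd K g _ v m0 vv vD Eb.
rewrite Es Et => <-; [|by lia..].
rewrite -scaler_nat; apply/subalgZ/SubalgGen.
exists (s + t)%N.*2, (neighbor_of (dplus (s + t)%N.*2) v).
by split=> //; [lia | lia | right].
Qed.

Lemma frakA_fg (K : numFieldType) g : finitely_generated (@frakA K g).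
Proof.
have [s [sG Gs]] := power_forms_fg (@theta4 K g) (@theta_form K g).
exists s => p; rewrite frakA_power_forms; split; apply: subalg_trans => // x xs.
exact/SubalgGen/sG.
Qed.

Theorem mainTheorem10 (R : realType) (g : nat) (hg : (1 <= g)%N) :
  finitely_generated (@frakA R[i] g).
Proof. exact: frakA_fg. Qed.
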